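(* Let $d,l\ge 1$ be integers, let $n_1,\dots,n_d$ be positive integers, and let $M\subset\mathcal{P}([d])$ be non-empty. Let $E$ be the set of points of $[n_1]\times\dots\times[n_d]$ whose coordinates are not all pairwise distinct. If $A\subset[n_1]\times\dots\times[n_d]$ satisfies $\mathrm{c}_M(A\setminus E)\ge d^d|M|\,l$, then there exist pairwise disjoint sets $X_1\subset[n_1],\dots,X_d\subset[n_d]$ such that \[\mathrm{c}_M\big(A\cap(X_1\times\dots\times X_d)\big)\ge l.\]
   Context: $[k]=\{1,\dots,k\}$. For $B \subset [d]$, a $B$-subspace is a maximal subset $S$ of $[n_1]\times\dots\times[n_d]$ such that $x_i = y_i$ whenever $x,y\in S$ and $i \notin B$. For non-empty $M\subset\mathcal{P}([d])$, an $M$-subspace is a $B$-subspace for some $B\in M$. The $M$-covering number $\mathrm{c}_M(A)$ of $A\subset[n_1]\times\dots\times[n_d]$ is the smallest nonnegative integer $k$ such that $A$ is contained in a union of $k$ $M$-subspaces. *)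

(* Defs.v *)
From mathcomp Require Import all_boot.

Set Implicit Arguments.
Unset Strict Implicit.
Unset Printing Implicit Defensive.

(* The interval [k] = {1, ..., k} is represented by 'I_k = {0, ..., k - 1}: every
   coordinate is shifted by one, so coordinates taken from different factors are
   compared through their values in nat. *)
Definition grid (d : nat) (n : 'I_d -> nat) : finType :=
  {dffun forall i : 'I_d, 'I_(n i)}.

Section Covering.

Variables (d : nat) (n : 'I_d -> nat).
Implicit Types (x y : grid n) (A S : {set grid n}).
Implicit Types (B : {set 'I_d}) (M : {set {set 'I_d}}).

Definition constant_off B S : bool :=
  [forall x in S, forall y in S, forall i : 'I_d, (i \notin B) ==> (x i == y i)].

Definition is_subspace B S : bool := maxset (constant_off B) S.

Definition is_Msubspace M S : bool := [exists B in M, is_subspace B S].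

Definition coverable M A (k : nat) : bool :=
  [exists t : k.-tuple {set grid n},
    all (is_Msubspace M) t && (A \subset \bigcup_(S <- t) S)].

Lemma coverable_ex M A : M != set0 -> exists k, coverable M A k.
Proof.
case/set0Pn=> B BM.
have sub1 x : {S | is_subspace B S & [set x] \subset S}.
  apply: maxset_exists; apply/forall_inP=> y /set1P->.
  by apply/forall_inP=> z /set1P->; apply/forallP=> i; rewrite eqxx implybT.
pose F x := s2val (sub1 x).
exists (size (map F (enum A))); apply/existsP; exists (in_tuple (map F (enum A))).
apply/andP; split.
  apply/allP=> S /mapP[x _ ->]; apply/existsP; exists B; rewrite BM.
  exact: (s2valP (sub1 x)).
apply/subsetP=> x xA; rewrite /= big_map big_enum; apply/bigcupP; exists x => //.
by have /subsetP-> := s2valP' (sub1 x); rewrite ?set11.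
Qed.

(* Coverability by some k is guaranteed only when M is non-empty, hence the
   proof argument. *)
Definition covering_number M (M0 : M != set0) A : nat :=
  ex_minn (coverable_ex A M0).

Definition repeated_coords : {set grid n} :=
  [set x : grid n | [exists i, exists j, (i != j) && (x i == x j :> nat)]].

End Covering.

Definition pairwise_disjoint (d : nat) (n : 'I_d -> nat)
    (X : forall i : 'I_d, {set 'I_(n i)}) : Prop :=
  forall (i j : 'I_d) (a : 'I_(n i)) (b : 'I_(n j)),
    i != j -> a \in X i -> b \in X j -> a <> b :> nat.

(* Main.v *)
Require Import Defs.
From mathcomp Require Import all_boot.

(** Colour the values of the coordinates with [d] colours and let [X_i] be the
values of colour [i]. A point with distinct coordinates lies in
[X_1 * ... * X_d] for a proportion [d ^ -d] of all colourings. If every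
colouring admitted a cover by fewer than [l] subspaces, these covers, averaged
over the colourings and multiplied by [d ^ d], would form a fractional cover of
[A \ E] of weight less than [d ^ d * l]. A point lies on at most [#|M|]
[M]-subspaces, so those of weight at least [1 / #|M|] already cover [A \ E],
and there are fewer than [d ^ d * #|M| * l] of them. *)

Set Implicit Arguments.
Unset Strict Implicit.
Unset Printing Implicit Defensive.

Lemma exchange_card (I J : finType) (P : pred I) (R : I -> J -> bool) :
  \sum_(i | P i) #|[set j | R i j]| = \sum_j #|[set i | P i & R i j]|.
Proof.
under eq_bigr => i _ do rewrite -sum1dep_card.
rewrite (exchange_big_dep predT) //=.
by apply: eq_bigr => j _; rewrite sum1dep_card.
Qed.

Lemma markov_card (I : finType) (P : pred I) (w : I -> nat) (t : nat) :
  #|[set i | P i & t <= w i]| * t <= \sum_(i | P i) w i.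
Proof.
rewrite -sum_nat_const big_mkcond [leqRHS]big_mkcond /=; apply: leq_sum => i _.
by rewrite inE; case: (P i) => //=; case: ifP.
Qed.

Lemma exists_geq_average (I : finType) (P : pred I) (w : I -> nat) (m t : nat) :
  0 < t -> #|P| <= m -> t <= \sum_(i | P i) w i ->
  exists2 i, P i & t <= w i * m.
Proof.
move=> t_gt0 Pm tw; have P_gt0 : 0 < #|P|.
  rewrite lt0n; apply: contraTneq tw => /card0_eq P0.
  by rewrite big_pred0 // -ltnNge.
have [i Pi max_i] := eq_bigmax_cond w P_gt0; exists i => //.
rewrite (leq_trans tw) // mulnC (@leq_trans (#|P| * w i)) ?leq_mul //.
by rewrite -sum_nat_const -max_i; apply: leq_sum => j; apply: leq_bigmax_cond.
Qed.

Lemma card_ffun_extending (I V T : finType) (f : I -> V) (g : I -> T) :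
  injective f ->
  #|[set c : {ffun V -> T} | [forall i, c (f i) == g i]]| * #|T| ^ #|I|
    = #|T| ^ #|V|.
Proof.
move=> f_inj.
pose F v : pred T := if [pick i | f i == v] is Some i then pred1 (g i) else predT.
have F_codom i : F (f i) = pred1 (g i).
  by rewrite /F; case: pickP => [j /eqP/f_inj -> // | /(_ i)]; rewrite eqxx.
have F_notin v : v \notin codom f -> F v = predT.
  by rewrite /F; case: pickP => // i /eqP <-; rewrite codom_f.
have -> : #|[set c : {ffun V -> T} | [forall i, c (f i) == g i]]| = #|family F|.
  rewrite cardsE; apply: eq_card => c; rewrite unfold_in /=.
  apply/forallP/familyP => [cg v | cF i].
    have [/codomP[i ->] | /F_notin-> //] := boolP (v \in codom f).
    by rewrite F_codom inE cg.
  by have := cF (f i); rewrite F_codom.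
rewrite card_family foldrE big_map big_enum /= (bigID (mem (codom f))) /=.
rewrite big1 ?mul1n => [|v /codomP[i ->]]; last by rewrite F_codom card1.
under eq_bigr => v /F_notin-> do [].
rewrite prod_nat_const -expnD -(card_codom f_inj) addnC.
by rewrite -(cardC (mem (codom f))); congr (_ ^ (_ + _)).
Qed.

Section FractionalCovers.

Variables (T : finType) (F : {set {set T}}) (A : {set T}).

(* Cleared of denominators: the rational weights of the cover are [w S / t]. *)
Definition fractional_cover (w : {set T} -> nat) (t : nat) : Prop :=
  {in A, forall x, t <= \sum_(S in F | x \in S) w S}.

Lemma fractional_cover_rounding (w : {set T} -> nat) (m t : nat) :
  0 < t -> {in A, forall x, #|[set S in F | x \in S]| <= m} ->
  fractional_cover w t ->
  exists G : {set {set T}},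
    [/\ G \subset F, A \subset cover G & #|G| * t <= (\sum_(S in F) w S) * m].
Proof.
move=> t_gt0 degree cov; exists [set S | (S \in F) && (t <= w S * m)]; split.
- by apply/subsetP=> S; rewrite inE => /andP[].
- apply/subsetP=> x xA; have := degree x xA; rewrite cardsE => deg_x.
  have [S /andP[SF xS] heavy] := exists_geq_average t_gt0 deg_x (cov x xA).
  by apply/bigcupP; exists S; rewrite ?inE ?SF.
- by rewrite big_distrl; apply: markov_card.
Qed.

Variables (I : finType) (C : I -> {set {set T}}) (r : nat).
Hypothesis CF : forall c, C c \subset F.

Definition multiplicity (S : {set T}) : nat := #|[set c | S \in C c]|.

Lemma sum_multiplicity : \sum_(S in F) multiplicity S = \sum_c #|C c|.
Proof.
rewrite exchange_card; apply: eq_bigr => c _; apply: eq_card => S.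
by rewrite inE andb_idl // => /(subsetP (CF c)).
Qed.

Lemma multiplicity_fractional_cover (t : nat) :
  {in A, forall x, t <= #|[set c | x \in cover (C c)]| * r} ->
  fractional_cover (fun S => multiplicity S * r) t.
Proof.
move=> often x /often/leq_trans-> //.
rewrite -big_distrl leq_mul2r; apply/orP; right.
rewrite exchange_card -sum1dep_card big_mkcond; apply: leq_sum => c _.
case: bigcupP => // -[S SC xS]; rewrite card_gt0; apply/set0Pn; exists S.
by rewrite inE (subsetP (CF c)) ?xS.
Qed.

Lemma cover_by_averaging (m k : nat) :
  0 < #|I| -> (forall c, #|C c| <= k) ->
  {in A, forall x, #|[set S in F | x \in S]| <= m} ->
  {in A, forall x, #|I| <= #|[set c | x \in cover (C c)]| * r} ->
  exists G : {set {set T}},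
    [/\ G \subset F, A \subset cover G & #|G| <= r * m * k].
Proof.
move=> I_gt0 Ck degree /multiplicity_fractional_cover cov.
have [G [GF AG G_le]] := fractional_cover_rounding I_gt0 degree cov.
exists G; split=> //; rewrite -(leq_pmul2r I_gt0) (leq_trans G_le) //.
rewrite -big_distrl /= sum_multiplicity -mulnA mulnC -[leqRHS]mulnA leq_mul //.
by rewrite mulnC -sum_nat_const; apply: leq_sum.
Qed.

End FractionalCovers.

Section Subspaces.

Variables (d : nat) (n : 'I_d -> nat).
Implicit Types (x : grid n) (A S : {set grid n}).
Implicit Types (B : {set 'I_d}) (M : {set {set 'I_d}}).

Definition cylinder B x : {set grid n} :=
  [set y : grid n | [forall i, (i \notin B) ==> (y i == x i)]].

Lemma subspace_cylinder B S x : is_subspace B S -> x \in S -> S = cylinder B x.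
Proof.
case/maxsetP=> /forall_inP constS maxS xS; symmetry; apply: maxS.
  apply/forall_inP=> y; rewrite inE => /forallP yP.
  apply/forall_inP=> z; rewrite inE => /forallP zP.
  apply/forallP=> i; apply/implyP=> iB.
  by rewrite (eqP (implyP (yP i) iB)) (eqP (implyP (zP i) iB)).
apply/subsetP=> y yS; rewrite inE; apply/forallP=> i.
by have /forall_inP/(_ x xS)/forallP := constS y yS.
Qed.

Definition Msubspaces M : {set {set grid n}} := [set S | is_Msubspace M S].

Lemma card_Msubspaces_through M x : #|[set S in Msubspaces M | x \in S]| <= #|M|.
Proof.
apply: leq_trans (leq_imset_card (cylinder^~ x) (mem M)).
apply/subset_leq_card/subsetP=> S; rewrite !inE => /andP[/exists_inP[B BM BS] xS].
by apply/imsetP; exists B => //; apply: subspace_cylinder.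
Qed.

Lemma covering_number_leP M (M0 : M != set0) A (k : nat) :
  reflect (exists G : {set {set grid n}},
             [/\ G \subset Msubspaces M, A \subset cover G & #|G| <= k])
          (covering_number M0 A <= k).
Proof.
rewrite /covering_number; case: ex_minnP => m coverable_m m_min.
apply: (iffP idP) => [mk | [G [/subsetP GM AG Gk]]].
  have [t /andP[/allP tM tA]] := existsP coverable_m.
  exists [set S in tval t]; split.
  - by apply/subsetP=> S; rewrite !inE => /tM.
  - apply: (subset_trans tA); rewrite bigcup_seq; apply/bigcupsP=> S St.
    by apply: bigcup_sup; rewrite inE.
  - by rewrite cardsE (leq_trans (card_size _)) ?size_tuple.
apply: leq_trans Gk; apply: m_min; apply/existsP.
exists (Tuple (introT eqP (esym (cardE G)))); rewrite /= big_enum AG andbT.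
by apply/allP=> S; rewrite mem_enum => /GM; rewrite inE.
Qed.

End Subspaces.

Section Colorings.

Variables (d : nat) (n : 'I_d -> nat).

Local Notation coloring := {ffun 'I_(\max_i n i) -> 'I_d}.

Definition embed_value (i : 'I_d) : 'I_(n i) -> 'I_(\max_i n i) :=
  widen_ord (leq_bigmax i).

Definition color_classes (c : coloring) (i : 'I_d) : {set 'I_(n i)} :=
  [set a | c (embed_value a) == i].

Lemma color_classes_disjoint (c : coloring) : pairwise_disjoint (color_classes c).
Proof.
move=> i j a b ij; rewrite !inE => /eqP ca /eqP cb ab; case/eqP: ij.
by rewrite -ca -cb; congr (c _); apply: val_inj.
Qed.

Lemma embed_coords_inj (x : grid n) :
  x \notin repeated_coords n -> injective (fun i => embed_value (x i)).
Proof.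
move=> xE i j /(congr1 val) /= xij; apply/eqP; apply: contraNT xE => ij.
rewrite inE; apply/existsP; exists i; apply/existsP; exists j.
by rewrite ij xij eqxx.
Qed.

Lemma card_colorings_through (x : grid n) : x \notin repeated_coords n ->
  #|[set c : coloring | x \in setXn (color_classes c)]| * d ^ d = #|{: coloring}|.
Proof.
move/embed_coords_inj/(card_ffun_extending id); rewrite card_ffun !card_ord => <-.
congr (#|pred_of_set _| * _); apply/setP=> c; rewrite !inE.
by apply: eq_forallb => i; rewrite inE.
Qed.

Lemma covering_number_le_color_classes (M : {set {set 'I_d}}) (M0 : M != set0)
    (A : {set grid n}) (k : nat) :
  0 < d ->
  (forall c, covering_number M0 (A :&: setXn (color_classes c)) <= k) ->
  covering_number M0 (A :\: repeated_coords n) <= d ^ d * #|M| * k.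
Proof.
move=> d_gt0 le_k.
have [C CP] := fin_all_exists (fun c => covering_number_leP M0 _ k (le_k c)).
apply/covering_number_leP; apply: (@cover_by_averaging _ _ _ _ C) => [c||c|x _|x].
- by case: (CP c).
- by rewrite card_ffun !card_ord expn_gt0 d_gt0.
- by case: (CP c).
- exact: card_Msubspaces_through.
rewrite inE => /andP[xE xA]; rewrite -(card_colorings_through xE) leq_mul2r.
apply/orP; right; apply/subset_leq_card/subsetP=> c.
by rewrite !in_set => xc; case: (CP c) => _ /subsetP-> //; rewrite inE xA in_set.
Qed.

End Colorings.

Theorem theorem2p4 (d l : nat) (n : 'I_d -> nat) (M : {set {set 'I_d}})
    (d_gt0 : 1 <= d) (l_gt0 : 1 <= l) (n_gt0 : forall i, 0 < n i)
    (M0 : M != set0) (A : {set grid n}) :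
  d ^ d * #|M| * l <= covering_number M0 (A :\: repeated_coords n) ->
  exists X : forall i : 'I_d, {set 'I_(n i)},
    pairwise_disjoint X /\ l <= covering_number M0 (A :&: setXn X).
Proof.
move=> large.
pose A_in c := A :&: setXn (color_classes (n := n) c).
have [c large_c | small] := pickP (fun c => l <= covering_number M0 (A_in c)).
  by exists (color_classes c); split=> //; apply: color_classes_disjoint.
have le_pred c : covering_number M0 (A_in c) <= l.-1.
  by rewrite -ltnS prednK // ltnNge small.
have := leq_trans large (covering_number_le_color_classes d_gt0 le_pred).
rewrite leq_pmul2l; first by rewrite -ltnS prednK // ltnn.
by rewrite muln_gt0 expn_gt0 d_gt0 card_gt0.
Qed.
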